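(* If $C\subseteq\mathbb H$ is a convex open set, then its characteristic set $\Sigma(C)$ admits the decomposition $\Sigma(C)=\Sigma^-\cup\Sigma^+$, where $\Sigma^-,\Sigma^+$ are two closed, disjoint, horizontal segments (possibly points). Moreover, if $0\in\mathrm{int}(C)$, then the horizontal plane $\mathrm H_0$ separates $\Sigma^-$ from $\Sigma^+$.
   Context: The Heisenberg group $\mathbb H$ is $\mathbb R^3=\mathbb C\times\mathbb R$ with group law $(z,t)(z',t')=(z+z',t+t'+2\,\mathrm{Im}(z\bar z'))$, where for $z=x+iy$, $z'=x'+iy'$, $\mathrm{Im}(z\bar z')=yx'-xy'$. Convexity is the usual one in the vector space $\mathbb R^3$. For $p=(z,t)\in\mathbb H$ the horizontal plane at $p$ is $\mathrm H_p=\{(z',t')\in\mathbb H : t'=t+2\,\mathrm{Im}(z\bar z')\}$; in particular $\mathrm H_0=\{t=0\}$. Given $p\in\partial C$ and a plane $\pi$ passing through $p$, $\pi$ is a supporting plane for $C$ at $p$ if $\pi\cap\overline C\subseteq\partial C$. The characteristic set is $\Sigma(C)=\{p\in\partial C : \mathrm H_p \text{ is a supporting plane for } C \text{ at } p\}$. A line $\ell$ is horizontal if $\ell\subseteq\mathrm H_p$ for one (equivalently all) $p\in\ell$; a horizontal segment is a segment of a horizontal line.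
   Formalization: For unbounded (or empty) C the two horizontal segments may be empty or unbounded (for C={t>0} the characteristic set is the single point 0, so the literal claim fails); for bounded nonempty C both are genuine segments with endpoints, possibly points. *)

(* Defs.v *)
From HB Require Import structures.
From mathcomp Require Import all_boot all_order all_algebra.
From mathcomp Require Import all_classical all_reals all_analysis.

Set Implicit Arguments.
Unset Strict Implicit.
Unset Printing Implicit Defensive.

Import Order.TTheory GRing.Theory Num.Theory.
Import numFieldNormedType.Exports.

Local Open Scope classical_set_scope.
Local Open Scope ring_scope.

(* A point (z, t) of C x R with z = x + i y is the row vector (x, y, t).  The
   norm of 'rV[R]_3 is the max norm; its topology is the usual one of R^3. *)
Notation heis R := 'rV[R]_3.

Section Heisenberg.
Variable R : realType.
Implicit Types (p q a b : heis R) (C S l : set (heis R)).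

Definition xcoord p : R := p 0 0.
Definition ycoord p : R := p 0 1.
Definition tcoord p : R := p 0 2.

(* Im (z * conj z') *)
Definition imzz p q : R := ycoord p * xcoord q - xcoord p * ycoord q.

Definition hmul p q : heis R :=
  \row_(i < 3) (p 0 i + q 0 i + (if i == 2 then 2 * imzz p q else 0)).

(* The plane H_p is the graph of this affine function of the z-part of q. *)
Definition hheight p q : R := tcoord p + 2 * imzz p q.

Definition hplane p : set (heis R) := [set q | tcoord q = hheight p q].

Definition hbelow p : set (heis R) := [set q | tcoord q < hheight p q].

Definition habove p : set (heis R) := [set q | hheight p q < tcoord q].

Definition boundary C : set (heis R) := closure C `\` interior C.

Definition is_plane (P : set (heis R)) : Prop :=
  exists2 n : 'cV[R]_3, n != 0 & exists c : R, P = [set q | (q *m n) 0 0 = c].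

Definition supporting_plane C p (P : set (heis R)) : Prop :=
  [/\ boundary C p, is_plane P, P p & P `&` closure C `<=` boundary C].

Definition characteristic_set C : set (heis R) :=
  [set p | supporting_plane C p (hplane p)].

Definition is_line l : Prop :=
  exists p, exists2 v : heis R, v != 0 & l = [set p + s *: v | s in [set: R]].

Definition horizontal_line l : Prop :=
  is_line l /\ exists2 p, l p & l `<=` hplane p.

(* A segment of a line is a convex subset of it: it may be a point, and also
   empty or unbounded, because for an unbounded C one of the two segments may be
   missing (C = {t > 0}, where the characteristic set is {0}) or be a half-line
   (C = {y > 0, t > 0}, where it is {x >= 0, y = t = 0}). *)
Definition horizontal_segment S : Prop :=
  convex_set S /\ exists2 l, horizontal_line l & S `<=` l.

(* a = b is allowed: the segment is then a point. *)
Definition segment_between a b : set (heis R) :=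
  [set a + s *: (b - a) | s in `[0, 1]].

Definition has_endpoints S : Prop := exists a b, S = segment_between a b.

Definition hplane_separates p S1 S2 : Prop :=
  S1 `<=` hbelow p /\ S2 `<=` habove p.

End Heisenberg.

(* Main.v *)
(* Write B(p, q) for the height of q above the plane H_p.  It is affine in each
   variable and skew, B(q, p) = - B(p, q).  A point p of the closure of C is
   characteristic iff B(p, _) has a constant sign on C; let Sigma+ (Sigma-) be
   the set of those p for which it is nonpositive (nonnegative).  Both are
   closed and convex.  If p and q lie in the same one, then B(p, q) and
   B(q, p) = - B(p, q) have the same sign, so B(p, q) = 0; points that are
   pairwise in horizontal position are on one horizontal line.
   When C is bounded, a point of Sigma+ is an optimal strategy of the symmetric
   zero-sum game with payoff B on the closure of C: such a strategy exists by
   the minimax theorem. *)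

Require Import Defs.
From HB Require Import structures.
From mathcomp Require Import all_boot all_order all_algebra.
From mathcomp Require Import all_classical all_reals all_analysis.
From mathcomp Require Import ring lra.

Set Implicit Arguments.
Unset Strict Implicit.
Unset Printing Implicit Defensive.

Import Order.TTheory GRing.Theory Num.Theory.
Import numFieldNormedType.Exports.

Local Open Scope classical_set_scope.
Local Open Scope ring_scope.

(** * Convex sets and their closures *)

Lemma convex_setP (R : realType) (V : lmodType R) (A : set V) :
  convex_set A <->
  forall x y (s : R), 0 <= s <= 1 -> A x -> A y -> A (s *: x + (1 - s) *: y).
Proof.
split=> [cA x y s s01 Ax Ay | cA x y l /set_mem Ax /set_mem Ay].
  have := cA x y (Itv01 (andP s01).1 (andP s01).2).
  by move=> /(_ (mem_set Ax) (mem_set Ay)) /set_mem.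
by apply/mem_set/cA => //; rewrite ge0 le1.
Qed.

Lemma convex_closure (R : realType) (V : normedModType R) (A : set V) :
  convex_set A -> convex_set (closure A).
Proof.
move=> /convex_setP cA; apply/convex_setP => x y s s01 clx cly.
have close z (e : R) : 0 < e -> closure A z -> exists2 a, A a & `|z - a| < e.
  move=> e0 clz; have [a [Aa]] := clz _ (nbhsx_ballx z e e0).
  by rewrite -ball_normE /=; exists a.
move=> B /nbhs_ballP [e /= e0 sB].
have [a Aa xa] := close x _ (divr_gt0 e0 (ltr0n _ 2)) clx.
have [b Ab yb] := close y _ (divr_gt0 e0 (ltr0n _ 2)) cly.
exists (s *: a + (1 - s) *: b); split; first exact: cA.
apply: sB; rewrite -ball_normE /=.
have -> : s *: x + (1 - s) *: y - (s *: a + (1 - s) *: b) =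
          s *: (x - a) + (1 - s) *: (y - b).
  by rewrite !scalerBr opprD addrACA.
apply: le_lt_trans (ler_normD _ _) _; rewrite !normrZ.
case/andP: s01 => s0 s1; rewrite (ger0_norm s0) ger0_norm ?subr_ge0//.
have := normr_ge0 (x - a); have := normr_ge0 (y - b).
nra.
Qed.

(** * Scalar estimates for a first-order minimality argument *)

Lemma ge0_of_quadratic (R : realType) (a b : R) : 0 <= b ->
  (forall s, 0 < s -> s <= 1 -> 0 <= 2 * s * a + s ^+ 2 * b) -> 0 <= a.
Proof.
move=> b0 h; rewrite leNgt; apply/negP => a0.
(* If a < 0, this s lies in (0, 1] and gives 2 a + s b = (1 + s) a < 0. *)
pose s := - a / (b - a).
have ba : 0 < b - a by lra.
have s0 : 0 < s by rewrite divr_gt0//; lra.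
have sba : s * (b - a) = - a by rewrite /s divfK// gt_eqF.
have s1 : s <= 1 by rewrite ler_pdivrMr//; lra.
have := h _ s0 s1; nra.
Qed.

(** The derivative 2 max(0, u) of max(0, u)^2 is Lipschitz with constant 2; hence this second-order
    bound along the segment from b to c. *)
Lemma max0_sqr_affine (R : realType) (s b c : R) :
  Num.max 0 (s * c + (1 - s) * b) ^+ 2 - Num.max 0 b ^+ 2 <=
  2 * s * (Num.max 0 b * (c - b)) + s ^+ 2 * (c - b) ^+ 2.
Proof.
set m := Num.max 0 b.
have -> : 2 * s * (m * (c - b)) + s ^+ 2 * (c - b) ^+ 2 =
          2 * m * (s * (c - b)) + (s * (c - b)) ^+ 2 by ring.
have -> : s * c + (1 - s) * b = b + s * (c - b) by ring.
move: (s * (c - b)) => e.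
rewrite /m /Num.max; case: ltrP => h1; case: ltrP => h2; nra.
Qed.

(** * Optimal strategies of symmetric zero-sum games *)

Section SymmetricGame.
Variables (R : realType) (V : normedModType R) (K : set V) (f : V -> V -> R).
Hypothesis K_compact : compact K.
Hypothesis K_convex : convex_set K.
Hypothesis K0 : K !=set0.
Hypothesis f_continuous : forall y, continuous (f^~ y).
Hypothesis f_affine : forall (s : R) x x' y,
  f (s *: x + (1 - s) *: x') y = s * f x y + (1 - s) * f x' y.
Hypothesis f_skew : forall x y, f x y = - f y x.

Let loss x y := Num.max 0 (f x y).

(* At a minimizer x of g = \sum_y max(0, f x y)^2, moving towards each z of the
   family cannot decrease g to first order.  Weighting these inequalities by
   max(0, f x z) and summing, the terms in f z y cancel by skew-symmetry, and
   what remains says that g x = 0. *)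
Lemma finite_symmetric_game (ys : seq V) : {in ys, forall y, K y} ->
  exists2 x, K x & {in ys, forall y, f x y <= 0}.
Proof.
move=> Kys; pose g x := \sum_(y <- ys) loss x y ^+ 2.
have cg : continuous g.
  rewrite /g; elim: ys {Kys g} => [|y ys IH] x.
    by under eq_fun do rewrite big_nil; exact: cvg_cst.
  under eq_fun do rewrite big_cons.
  apply: cvgD; last exact: IH.
  have cl : loss z y @[z --> x] --> loss x y.
    by apply: continuous_max; [exact: cst_continuous|exact: f_continuous].
  by under eq_fun do rewrite expr2; apply: cvgM.
have [x /set_mem Kx xmin] :=
  compact_EVT_min K0 K_compact (continuous_subspaceT cg).
exists x => //.
have first_order z : z \in ys ->
    0 <= \sum_(y <- ys) loss x y * (f z y - f x y).
  move=> zys.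
  apply: (@ge0_of_quadratic _ _ (\sum_(y <- ys) (f z y - f x y) ^+ 2)).
    by apply: sumr_ge0 => y _; exact: sqr_ge0.
  move=> s s0 s1.
  have s01 : 0 <= s <= 1 by rewrite ltW.
  have := xmin _ (mem_set ((convex_setP _).1 K_convex _ _ _ s01 (Kys _ zys) Kx)).
  rewrite -subr_ge0 => /le_trans; apply.
  rewrite /g -sumrB !mulr_sumr -big_split; apply: ler_sum => y _ /=.
  by rewrite /loss f_affine; exact: max0_sqr_affine.
have pay : \sum_(z <- ys) \sum_(y <- ys) loss x z * loss x y * f z y = 0.
  set S := (LHS); suff : S = - S by lra.
  rewrite {1}/S exchange_big /= -sumrN; apply: eq_bigr => z _.
  rewrite -sumrN; apply: eq_bigr => y _.
  by rewrite f_skew; ring.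
have tot : (\sum_(z <- ys) loss x z) * g x <= 0.
  rewrite -oppr_ge0.
  (* Since max(0, u) u = max(0, u)^2, the weighted first-order terms add up to the vanishing sum of
     [pay] minus the product. *)
  have -> : - ((\sum_(z <- ys) loss x z) * g x) =
            \sum_(z <- ys) loss x z * \sum_(y <- ys) loss x y * (f z y - f x y).
    rewrite -[LHS]add0r -[X in X + _]pay mulr_suml -sumrN -big_split /=.
    apply: eq_bigr => z _; rewrite /g !mulr_sumr -sumrN -big_split /=.
    apply: eq_bigr => y _; rewrite /loss /Num.max; case: (ltrP 0 (f x y)); nra.
  rewrite big_seq; apply: sumr_ge0 => z zys.
  by rewrite mulr_ge0 ?first_order// /loss le_max lexx.
(* A positive f x y would make both factors in [tot] positive. *)
move=> y yys; rewrite leNgt; apply/negP => fxy.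
have ly : 0 < loss x y by rewrite /loss lt_max fxy orbT.
move: tot; rewrite leNgt => /negP; apply.
have pos (F : V -> R) : (forall z, 0 <= F z) -> 0 < F y -> 0 < \sum_(z <- ys) F z.
  move=> F0 Fy; rewrite (big_rem y) //= ltr_pwDl// sumr_ge0//.
apply: mulr_gt0; apply: pos => //.
- by move=> z; rewrite /loss le_max lexx.
- by move=> z; exact: sqr_ge0.
- exact: exprn_gt0.
Qed.

(** Without a solution, the open sets where f x y > 0, for y in K, cover K; a finite subcover
    contradicts the finite case. *)
Lemma symmetric_game : exists2 x, K x & forall y, K y -> f x y <= 0.
Proof.
apply: contrapT => nosol.
have : cover_compact K by rewrite -compact_cover.
move=> /(_ V K (fun y => [set x | 0 < f x y])) [].
- by move=> y _; apply: open_comp (@open_gt _ 0) => x _; exact: f_continuous.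
- move=> x Kx; apply: contrapT => nx; apply: nosol; exists x => // y Ky.
  by rewrite leNgt; apply/negP => fxy; apply: nx; exists y.
move=> D DK cov.
have [|x Kx xD] := @finite_symmetric_game (finmap.enum_fset D).
  by move=> y /DK /set_mem.
have [y /= yD] := cov _ Kx.
by rewrite ltNge xD.
Qed.

End SymmetricGame.

(** * Compactness, and compact convex subsets of a line *)

Lemma compact_closure_of_bounded (R : realType) n (A : set 'rV[R]_n.+1) :
  bounded_set A -> compact (closure A).
Proof.
move=> bA.
have [M M0 AM] := ex_strict_bound_gt0 bA.
have cB : compact (closed_ball (0 : 'rV[R]_n.+1) M).
  apply: bounded_closed_compact; last exact: closed_ball_closed.
  exists M; split; first exact: num_real.
  move=> N MN x /=; rewrite closed_ballE// /closed_ball_ /= sub0r normrN.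
  by move=> /le_trans; apply; exact: ltW.
apply: (subclosed_compact _ cB); first exact: closed_closure.
by apply: closureS => x /AM; rewrite -ball_normE /= sub0r normrN.
Qed.

(** A coordinate in which the direction v is nonzero parametrises the line; its extreme values on S
    are attained at the endpoints. *)
Lemma compact_collinear_endpoints (R : realType) (S l : set (heis R)) :
  compact S -> convex_set S -> S !=set0 -> is_line l -> S `<=` l ->
  has_endpoints S.
Proof.
move=> cS /convex_setP cvS S0 [p [v v0 ->]] Sl.
have [i vi] : exists i, v 0 i != 0.
  by move/rV0Pn: v0.
have cf : {within S, continuous (fun q : heis R => q 0 i / v 0 i)}.
  apply: continuous_subspaceT => q; apply: (@cvgM _ _ (nbhs q)); last exact: cvg_cst.
  exact: coord_continuous.
have [a /set_mem Sa amin] := compact_EVT_min S0 cS cf.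
have [b /set_mem Sb bmax] := compact_EVT_max S0 cS cf.
have param q : S q -> q = a + (q 0 i / v 0 i - a 0 i / v 0 i) *: v.
  move=> /Sl [s _ <-]; have [t _ <-] := Sl _ Sa.
  by rewrite !mxE -mulrBl opprD addrACA subrr add0r mulrBl !mulfK// 
    -addrA -scalerDl [t + _]addrC subrK.
exists a, b; rewrite eqEsubset; split=> [q Sq|_ [s s01 <-]]; last first.
  rewrite /= in_itv /= in s01.
  have -> : a + s *: (b - a) = s *: b + (1 - s) *: a.
    by rewrite scalerBr scalerBl scale1r addrCA.
  exact: cvS.
have qa := amin _ (mem_set Sq); have qb := bmax _ (mem_set Sq).
have := param _ Sb; have := param _ Sq.
move: (b 0 i / v 0 i) (q 0 i / v 0 i) (a 0 i / v 0 i) qa qb.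
move=> B Q A AQ QB qE bE.
(* When the extreme parameters agree, S is the single point a. *)
have [AB|AB] := eqVneq A B.
  exists 0; first by rewrite /= in_itv /= lexx ler01.
  rewrite scale0r addr0 qE (_ : Q = A) ?subrr ?scale0r ?addr0//.
  by apply/le_anti; rewrite AQ AB QB.
have AB0 : 0 < B - A by rewrite subr_gt0 lt_neqAle AB (le_trans AQ).
exists ((Q - A) / (B - A)).
  by rewrite /= in_itv /= divr_ge0 ?subr_ge0 ?(le_trans AQ)//= ler_pdivrMr// mul1r lerD2r.
by rewrite bE addrAC subrr add0r scalerA divfK ?gt_eqF.
Qed.

(** * The height function and the sets Sigma+ and Sigma- *)

Section Characteristic.
Variable R : realType.
Implicit Types (p q a b : heis R) (C : set (heis R)) (e s : R).

(** The function B(p, q) of the overview; it vanishes exactly when q lies on H_p. *)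
Definition htilt p q : R := tcoord q - hheight p q.

Lemma htilt_skew p q : htilt p q = - htilt q p.
Proof. rewrite /htilt /hheight /imzz; ring. Qed.

Lemma htiltxx p : htilt p p = 0.
Proof. rewrite /htilt /hheight /imzz; ring. Qed.

Lemma htilt_affine s p p' q :
  htilt (s *: p + (1 - s) *: p') q = s * htilt p q + (1 - s) * htilt p' q.
Proof. rewrite /htilt /hheight /imzz /tcoord /xcoord /ycoord !mxE; ring. Qed.

Lemma htilt_affiner s p q q' :
  htilt p (s *: q + (1 - s) *: q') = s * htilt p q + (1 - s) * htilt p q'.
Proof. by rewrite htilt_skew htilt_affine !(htilt_skew p); ring. Qed.

Lemma htilt_continuousl q : continuous (htilt^~ q).
Proof.
move=> p; rewrite /htilt /hheight /imzz.
apply: (@cvgB _ _ _ (nbhs p)); first exact: cvg_cst.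
apply: (@cvgD _ _ _ (nbhs p)); first exact: coord_continuous.
apply: (@cvgM _ _ (nbhs p)); first exact: cvg_cst.
apply: (@cvgB _ _ _ (nbhs p)); apply: (@cvgM _ _ (nbhs p));
  by [exact: coord_continuous | exact: cvg_cst].
Qed.

Lemma htilt_continuousr p : continuous (htilt p).
Proof.
have -> : htilt p = (fun q => - htilt q p).
  by apply/funext => q; exact: htilt_skew.
move=> q; apply: (@cvgN _ _ _ (nbhs q)); exact: htilt_continuousl.
Qed.

(* Sigma+ is [touching 1 C] and Sigma- is [touching (- 1) C]. *)
Definition touching e C : set (heis R) :=
  [set p | closure C p /\ forall q, C q -> e * htilt p q <= 0].

Lemma closed_htilt_le0 e p : closed [set q | e * htilt p q <= 0].
Proof.
apply: (@closed_comp _ _ (fun q => e * htilt p q) [set x | x <= 0]) => //.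
by move=> x _; apply: (@cvgM _ _ (nbhs x)); [exact: cvg_cst|exact: htilt_continuousr].
Qed.

Lemma touching_closure e C p q :
  touching e C p -> closure C q -> e * htilt p q <= 0.
Proof.
move=> [_ Cp] clq.
suff : closure C `<=` [set q | e * htilt p q <= 0] by exact.
rewrite [X in _ `<=` X](closure_id _).1; last exact: closed_htilt_le0.
exact: closureS.
Qed.

Lemma closed_touching e C : closed (touching e C).
Proof.
(* Skew-symmetry turns the condition on p into closed conditions, one for each q in C. *)
have -> : touching e C =
    closure C `&` \bigcap_(q in C) [set p | (- e) * htilt q p <= 0].
  apply/seteqP; split=> p [clp Cp]; split=> // q Cq; have := Cp q Cq;
  by rewrite /= (htilt_skew q) ?mulrNN.
apply: closedI; first exact: closed_closure.
by apply: closed_bigI => q _; exact: closed_htilt_le0.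
Qed.

Lemma convex_touching e C : convex_set C -> convex_set (touching e C).
Proof.
move=> /convex_closure /convex_setP clC; apply/convex_setP.
move=> p p' s s01 [clp Cp] [clp' Cp']; split=> [|q Cq]; first exact: clC.
rewrite htilt_affine; have := Cp _ Cq; have := Cp' _ Cq.
by case/andP: s01 => *; nra.
Qed.

Lemma htilt_touching e C p q :
  e != 0 -> touching e C p -> touching e C q -> htilt p q = 0.
Proof.
move=> e0 Cp Cq; apply/eqP; rewrite -(mulrI_eq0 _ (mulfI e0)).
rewrite eq_le (touching_closure Cp Cq.1) /=.
by have := touching_closure Cq Cp.1; rewrite htilt_skew mulrN oppr_le0.
Qed.

(** A small vertical move of q in the direction of e stays in the open set C and raises e B(p, q) by
    a positive amount, so there is no room for equality. *)
Lemma touching_strict e C p q :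
  open C -> e != 0 -> touching e C p -> C q -> e * htilt p q < 0.
Proof.
move=> oC e0 [_ Cp] Cq.
pose v : heis R := \row_(i < 3) (if i == 2 then e else 0).
have /nbhs_ballP [r /= r0 rC] : nbhs q C by exact: open_nbhs_nbhs.
(* Chosen so that d |v| <= r / 2; the added 1 keeps the denominator positive. *)
pose d := r / 2 / (`|v| + 1).
have v1 : 0 < `|v| + 1 by rewrite ltr_wpDl.
have d0 : 0 < d by rewrite !divr_gt0.
have : C (q + d *: v).
  apply: rC; rewrite -ball_normE /= opprD addrA subrr sub0r normrN normrZ.
  rewrite gtr0_norm//.
  apply: (@le_lt_trans _ _ (d * (`|v| + 1))); first by rewrite ler_pM2l// lerDl.
  by rewrite /d divfK ?gt_eqF// ltr_pdivrMr// ltr_pMr// ltr1n.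
move=> /Cp.
have -> : htilt p (q + d *: v) = htilt p q + d * e.
  by rewrite /htilt /hheight /imzz /tcoord /xcoord /ycoord !mxE /=; ring.
have : 0 < d * e ^+ 2 by rewrite mulr_gt0// exprn_even_gt0.
by nra.
Qed.

(** The payoff e B is again skew and affine, so the game argument covers both signs. *)
Lemma touching_nonempty e C :
  convex_set C -> bounded_set C -> C !=set0 -> touching e C !=set0.
Proof.
move=> cvC bC [q0 Cq0].
have cK := compact_closure_of_bounded bC.
have K0 : closure C !=set0 by exists q0; exact: subset_closure.
have [||||p Kp pE] := @symmetric_game R _ _ (fun p q => e * htilt p q) cK _ K0.
- exact: convex_closure.
- by move=> y x; apply: (@cvgM _ _ (nbhs x)); [exact: cvg_cst|exact: htilt_continuousl].
- by move=> s x x' y /=; rewrite htilt_affine; ring.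
- by move=> x y; rewrite htilt_skew mulrN.
by exists p; split=> // q Cq; apply: pE; exact: subset_closure.
Qed.

(** Two distinct points of the set span a horizontal line, and B vanishing on all pairs puts every
    third point on it. An empty set or a single point lies on any suitable horizontal line. *)
Lemma touching_horizontal e C :
  convex_set C -> e != 0 -> horizontal_segment (touching e C).
Proof.
move=> cvC e0; split; first exact: convex_touching.
have coord3 (i : 'I_3) : i = 0 \/ i = 1 \/ i = 2.
  by case: i => -[|[|[]]]// ?; [left|right; left|right; right]; exact/val_inj.
have line p (v : heis R) : htilt p (p + v) = 0 -> v != 0 ->
    horizontal_line [set p + s *: v | s in [set: R]].
  move=> pv v0; split; first by exists p; exists v.
  exists p; first by exists 0; rewrite // scale0r addr0.
  move=> _ [s _ <-]; apply/eqP; rewrite -subr_eq0; apply/eqP.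
  rewrite -[LHS]/(htilt p (p + s *: v)).
  have -> : p + s *: v = s *: (p + v) + (1 - s) *: p.
    by rewrite scalerDr scalerBl scale1r (addrC (s *: p)) -addrA (addrC (s *: p))
       subrK addrC.
  by rewrite htilt_affiner pv htiltxx !mulr0 addr0.
(* A horizontal direction at p, with z-part 1. *)
pose w p : heis R := \row_(i < 3)
  (if i == 0 then 1 else if i == 2 then 2 * ycoord p else 0).
have wline p : horizontal_line [set p + s *: w p | s in [set: R]].
  apply: line.
    rewrite /htilt /hheight /imzz /tcoord /xcoord /ycoord !mxE /=
      /ycoord; ring.
  by apply/eqP => /rowP /(_ 0); rewrite !mxE /= => /eqP; rewrite oner_eq0.
have [[p Sp]|S0] := pselect (touching e C !=set0); last first.
  exists [set 0 + s *: w 0 | s in [set: R]]; first exact: wline.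
  by move=> p Sp; case: S0; exists p.
have [[q Sq qp]|Sp1] := pselect (exists2 q, touching e C q & q != p); last first.
  exists [set p + s *: w p | s in [set: R]]; first exact: wline.
  move=> q Sq; have [->|qp] := eqVneq q p; first by exists 0; rewrite // scale0r addr0.
  by case: Sp1; exists q.
exists [set p + s *: (q - p) | s in [set: R]].
  by apply: line; rewrite ?subr_eq0// addrC subrK; exact: htilt_touching Sp Sq.
move=> r Sr.
have pq := htilt_touching e0 Sp Sq; have pr := htilt_touching e0 Sp Sr.
have qr := htilt_touching e0 Sq Sr.
move: pq pr qr; rewrite /htilt /hheight /imzz => pq pr qr.
(* Matching x and y suffices: q and r both lie on H_p, which fixes t. *)
have mk s : xcoord r = xcoord p + s * (xcoord q - xcoord p) ->
    ycoord r = ycoord p + s * (ycoord q - ycoord p) ->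
    exists2 s, [set: R] s & p + s *: (q - p) = r.
  move=> xE yE; exists s => //; apply/rowP => i; rewrite !mxE.
  have [i0|[i1|i2]] := coord3 i.
  - by rewrite i0; exact/esym.
  - by rewrite i1; exact/esym.
  - rewrite i2; change (tcoord p + s * (tcoord q - tcoord p) = tcoord r).
    by move: pr; rewrite xE yE; nra.
(* The heights cancel in B(p, q) + B(q, r) - B(p, r), leaving a multiple of the determinant of the
   z-parts of q - p and r - p. *)
have cross : (ycoord q - ycoord p) * (xcoord r - xcoord p) =
             (xcoord q - xcoord p) * (ycoord r - ycoord p) by lra.
have [xpq|xpq] := eqVneq (xcoord q) (xcoord p); last first.
  have d0 : xcoord q - xcoord p != 0 by rewrite subr_eq0.
  apply: (mk ((xcoord r - xcoord p) / (xcoord q - xcoord p))).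
    by rewrite divfK// addrC subrK.
  by rewrite mulrAC [X in X / _]mulrC cross mulrAC divff// mul1r addrC subrK.
(* Points on H_p with the z-part of p are equal to p. *)
have ypq : ycoord q - ycoord p != 0.
  apply: contraNneq qp => /subr0_eq ypq; apply/eqP/rowP => i.
  case: (coord3 i) => [|[]] ->; [exact: xpq|exact: ypq|].
  by move: pq; rewrite /tcoord xpq ypq; lra.
apply: (mk ((ycoord r - ycoord p) / (ycoord q - ycoord p))).
  rewrite xpq subrr mulr0 addr0; apply/eqP; rewrite -subr_eq0.
  by rewrite -(mulrI_eq0 _ (mulfI ypq)) cross xpq subrr mul0r.
by rewrite divfK// addrC subrK.
Qed.

(** As C is open, a supporting H_p misses C, so B(p, _) has no zero on C and by convexity keeps its
    sign. Conversely, the strict inequality on C keeps H_p off C. *)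
Lemma characteristic_setE C : convex_set C -> open C ->
  characteristic_set C = touching (- 1) C `|` touching 1 C.
Proof.
move=> /convex_setP cvC oC; have CE := (interior_id C).1 oC.
apply/seteqP; split=> [p [[clp nip] _ _ sub]|p].
  have nz q : C q -> htilt p q != 0.
    move=> Cq; apply/negP => /eqP h0.
    suff [_] : boundary C q by rewrite CE.
    by apply: sub; split; [exact: subr0_eq|exact: subset_closure].
  have [neg|] := pselect (forall q, C q -> htilt p q <= 0).
    by right; split=> // q /neg; rewrite mul1r.
  move=> /existsNP [q /not_implyP [Cq /negP]]; rewrite -ltNge => hq.
  left; split=> // q' Cq'; rewrite mulN1r oppr_le0 leNgt; apply/negP => hq'.
  have d0 : 0 < htilt p q - htilt p q' by lra.
  (* The zero of the affine function B(p, _) on the segment from q' to q. *)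
  have Cz : C ((- htilt p q' / (htilt p q - htilt p q')) *: q +
      (1 - - htilt p q' / (htilt p q - htilt p q')) *: q').
    apply: cvC => //; apply/andP; split; last by rewrite ler_pdivrMr//; lra.
    by apply: divr_ge0; [rewrite oppr_ge0|]; exact: ltW.
  have := nz _ Cz; rewrite htilt_affiner => /eqP; apply.
  by field; rewrite gt_eqF.
have char e : e != 0 -> touching e C p -> characteristic_set C p.
  move=> e0 Sp; have nz q : C q -> htilt p q != 0.
    move=> Cq; have := touching_strict oC e0 Sp Cq.
    by apply: contraTneq => ->; rewrite mulr0 ltxx.
  split.
  - split; first exact: Sp.1.
    by rewrite CE => /nz; rewrite htiltxx eqxx.
  (* The normal (-2y, 2x, 1) of H_p, with constant t. *)
  - exists (\col_(i < 3) (if i == 0 then - 2 * ycoord p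
                         else if i == 1 then 2 * xcoord p else 1)).
      by apply/eqP => /colP /(_ 2); rewrite !mxE /= => /eqP; rewrite oner_eq0.
    exists (tcoord p); apply/funext => q; apply/propext.
    rewrite /hplane /= /hheight /imzz /tcoord /xcoord /ycoord !mxE !big_ord_recl big_ord0 !mxE /=.
    have -> : lift ord0 (lift ord0 ord0) = 2 :> 'I_3 by exact/val_inj.
    have -> : lift ord0 ord0 = 1 :> 'I_3 by exact/val_inj.
    by split; lra.
  - by apply/eqP; rewrite -subr_eq0 -/(htilt p p) htiltxx.
  - move=> q [pq clq]; split=> //; rewrite CE => /nz /eqP; apply.
    by rewrite /htilt pq subrr.
by case; apply: char; rewrite ?oppr_eq0 oner_eq0.
Qed.

End Characteristic.

Theorem theorem3p5 (R : realType) (C : set (heis R))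
    (C_convex : convex_set C) (C_open : open C) :
  exists Sm Sp : set (heis R),
    [/\ characteristic_set C = Sm `|` Sp,
        [/\ closed Sm, closed Sp & Sm `&` Sp = set0],
        horizontal_segment Sm /\ horizontal_segment Sp,
        (bounded_set C -> C !=set0 -> has_endpoints Sm /\ has_endpoints Sp)
      & (interior C 0 -> hplane_separates 0 Sm Sp)].
Proof.
have N1 : - 1 != 0 :> R by rewrite oppr_eq0 oner_eq0.
have P1 : 1 != 0 :> R by exact: oner_neq0.
exists (touching (- 1) C), (touching 1 C); split.
- exact: characteristic_setE.
- split; [exact: closed_touching|exact: closed_touching|].
  apply/seteqP; split=> // p [Sm Sp].
  (* A point p of the closure provides some q in C, where B(p, q) would have both strict signs. *)
  have [q [Cq _]] := Sm.1 _ filterT.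
  have := touching_strict C_open N1 Sm Cq; have := touching_strict C_open P1 Sp Cq.
  by rewrite /=; lra.
- by split; exact: touching_horizontal.
- move=> bC C0.
  suff ends e : e != 0 -> has_endpoints (touching e C) by split; exact: ends.
  move=> e0; have [cvS [l [lineS _] Sl]] := touching_horizontal C_convex e0.
  apply: (compact_collinear_endpoints _ cvS _ lineS Sl); last exact: touching_nonempty.
  have cK := compact_closure_of_bounded bC.
  by apply: subclosed_compact cK _; [exact: closed_touching|move=> p []].
- rewrite (interior_id C).1// => C0.
  (* Since B(p, 0) = - t, its strict sign tells the side of H_0 on which p lies. *)
  split=> p Sp.
    have := touching_strict C_open N1 Sp C0.
    by rewrite /hbelow /htilt /hheight /imzz /= /tcoord /xcoord /ycoord !mxE; lra.
  have := touching_strict C_open P1 Sp C0.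
  by rewrite /habove /htilt /hheight /imzz /= /tcoord /xcoord /ycoord !mxE; lra.
Qed.
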